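(* Let $X=X_{\rm lin}+\sum_{n\in A(X)}D_n$ be a local analytic vector field on $\mathbb{C}^\nu$, with $X_{\rm lin}=\sum_{i=1}^\nu\lambda_ix_i\partial_{x_i}$ and $\underline{\lambda}=(\lambda_1,\dots,\lambda_\nu)$. For $\underline{s}=(s_1,\dots,s_r)\in A^*(X)$, $s_i\in A(X)$, set $\omega_i=s_i\cdot\underline{\lambda}$ for $i=1,\dots,r$ and $\|\omega(\underline{s})\|=\omega_1+\dots+\omega_r$. Suppose that $X$ is non-resonant, i.e. $\|\omega(\underline{s})\|\ne0$ for all non-empty $\underline{s}\in A^*(X)$. Then $X$ is formally linearizable, by a formal automorphism of $\mathbb{C}[[x]]$ of the form $$Na=\sum_{\underline{s}\in A^*(X)}Na^{\underline{s}}D_{\underline{s}},$$ with $Na^\emptyset=1$ and, for all $\underline{s}=(s_1,\dots,s_r)\in A^*(X)$ with $r\ge1$, $$Na^{\underline{s}}=\frac{1}{\omega_1(\omega_1+\omega_2)\cdots(\omega_1+\omega_2+\dots+\omega_r)}.$$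
   Context: $x=(x_1,\dots,x_\nu)$. A local analytic vector field is $X=\sum_{i=1}^\nu X_i(x)\partial_{x_i}$ with $X_i\in\mathbb{C}\{x\}$ (convergent power series), $X_i(0)=0$. It is assumed in prepared form: its linear part is diagonal, $X_{\rm lin}=\sum_i\lambda_ix_i\partial_{x_i}$. The remainder decomposes uniquely as $X-X_{\rm lin}=\sum_{n\in A(X)}D_n$, where each $D_n$ is a non-zero derivation, homogeneous of degree $n=(n_1,\dots,n_\nu)$, i.e. $D_n(x^m)=c_{n,m}x^{n+m}$ with $c_{n,m}\in\mathbb{C}$ for all $m\in\mathbb{N}^\nu$; all $n_i\ge0$ except at most one that may equal $-1$, and $n_1+\dots+n_\nu\geq 1$. $A(X)$ is the set of degrees occurring, and $A^*(X)$ the set of finite sequences of elements of $A(X)$, including the empty one. $n\cdot\underline{\lambda}=\sum n_i\lambda_i$. For $\underline{s}=(s_1,\dots,s_r)$, $D_{\underline{s}}=D_{s_1}D_{s_2}\cdots D_{s_r}$ (composition of operators, $D_\emptyset=\mathrm{Id}$). That $Na$ linearizes $X$ means $X_{\rm lin}=Na\,X\,Na^{-1}$ as operators on $\mathbb{C}[[x]]$; an automorphism is an algebra automorphism of $\mathbb{C}[[x]]$. *)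

(* Defs.v *)
From HB Require Import structures.
From mathcomp Require Import all_boot all_order all_algebra.
From mathcomp Require Import complex.
From mathcomp Require Import mpoly.
From mathcomp Require Import boolp classical_sets functions cardinality fsbigop.
From mathcomp Require Import reals ereal esum.

Set Implicit Arguments.
Unset Strict Implicit.
Unset Printing Implicit Defensive.

Import Order.TTheory GRing.Theory Num.Theory.

Local Open Scope classical_set_scope.
Local Open Scope ring_scope.

(* Formal power series in nu variables: the coefficient families
   'X_{1..nu} -> K with the Cauchy product. The module structure is the
   pointwise one. Only that structure is copied from the function type, whose
   own product is pointwise. *)
Definition fps (nu : nat) (K : comNzRingType) : Type := 'X_{1..nu} -> K.

HB.instance Definition _ (nu : nat) (K : comNzRingType) :=
  GRing.Lmodule.copy (fps nu K) ('X_{1..nu} -> K^o).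

Section FpsRing.
Variables (nu : nat) (K : comNzRingType).
Local Notation F := (fps nu K).
Implicit Types (f g h : F) (m : 'X_{1..nu}).

Definition fps_one : F := fun m => (m == 0%MM)%:R.

Definition fps_mul f g : F := fun m =>
  \sum_(k : 'X_{1..nu < (mdeg m).+1} | (k <= m)%MM) f k * g (m - k)%MM.

(* The ring laws are transferred from {mpoly K[nu]} by truncation. *)
Definition fps_trunc (d : nat) f : {mpoly K[nu]} :=
  \sum_(k : 'X_{1..nu < d}) f k *: 'X_[k].

Lemma mcoeff_trunc d f m : (mdeg m < d)%N -> (fps_trunc d f)@_m = f m.
Proof.
move=> lt_md; rewrite /fps_trunc raddf_sum /=.
rewrite (bigD1 (BMultinom lt_md)) //= mcoeffZ mcoeffX eqxx mulr1.
rewrite big1 ?addr0 // => k; rewrite bmeqP /= => /negbTE ne.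
by rewrite mcoeffZ mcoeffX ne mulr0.
Qed.

Lemma fps_mulE f g (p q : {mpoly K[nu]}) m :
  (forall k, (k <= m)%MM -> p@_k = f k) ->
  (forall k, (k <= m)%MM -> q@_k = g k) ->
  fps_mul f g m = (p * q)@_m.
Proof.
move=> pf qg; rewrite (mcoeff_poly_mul_lin p q (ltnSn (mdeg m))).
by apply: eq_bigr => k le_km; rewrite pf // qg // lem_subr.
Qed.

Lemma mdeg_le_lt k m : (k <= m)%MM -> (mdeg k < (mdeg m).+1)%N.
Proof. by move=> le_km; rewrite ltnS -(submK le_km) mdegD leq_addl. Qed.

Lemma fps_mul_trunc f g m d : (mdeg m < d)%N ->
  fps_mul f g m = (fps_trunc d f * fps_trunc d g)@_m.
Proof.
move=> lt_md; apply: fps_mulE => k /mdeg_le_lt le_km;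
by rewrite mcoeff_trunc // (leq_trans le_km).
Qed.

Lemma fps_mulA : associative fps_mul.
Proof.
move=> f g h; apply/funext => m; pose d := (mdeg m).+1.
have T u k : (k <= m)%MM -> (fps_trunc d u)@_k = u k.
  by move=> /mdeg_le_lt lt_kd; rewrite mcoeff_trunc.
have TM u v k : (k <= m)%MM ->
    (fps_trunc d u * fps_trunc d v)@_k = fps_mul u v k.
  by move=> /mdeg_le_lt lt_kd; rewrite (fps_mul_trunc _ _ lt_kd).
rewrite (fps_mulE (T f) (TM g h)).
by rewrite (fps_mulE (TM f g) (T h)) mulrA.
Qed.

Lemma fps_mulC : commutative fps_mul.
Proof.
move=> f g; apply/funext => m.
by rewrite !(fps_mul_trunc _ _ (ltnSn (mdeg m))) mulrC.
Qed.

Lemma fps_mul1f : left_id fps_one fps_mul.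
Proof.
move=> f; apply/funext => m.
rewrite (@fps_mulE _ _ 1 (fps_trunc (mdeg m).+1 f)) ?mul1r ?mcoeff_trunc //.
- by move=> k _; rewrite mcoeff1.
- by move=> k /mdeg_le_lt lt_km; rewrite mcoeff_trunc.
Qed.

Lemma fps_mulDl : left_distributive fps_mul +%R.
Proof.
move=> f g h; apply/funext => m; apply: etrans (big_split _ _ _ _ _).
by apply: eq_bigr => k _; exact: mulrDl.
Qed.

Lemma fps_oner_neq0 : fps_one != 0.
Proof.
apply/eqP => /(congr1 (fun f : F => f 0%MM)) /eqP.
by rewrite /fps_one eqxx; apply/negP; exact: oner_neq0.
Qed.

HB.instance Definition _ := GRing.Zmodule_isComNzRing.Build (fps nu K)
  fps_mulA fps_mulC fps_mul1f fps_mulDl fps_oner_neq0.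

Lemma fps_scalerAl (c : K) f g : c *: (f * g) = (c *: f) * g.
Proof.
apply/funext => m; apply: etrans (mulr_sumr _ _ _ _) _.
by apply: eq_bigr => k _; exact: mulrA.
Qed.

HB.instance Definition _ :=
  GRing.Lmodule_isLalgebra.Build K (fps nu K) fps_scalerAl.
HB.instance Definition _ :=
  GRing.Lalgebra_isComAlgebra.Build K (fps nu K).

(* x^k for an integral exponent k, read as 0 when some k i is negative. *)
Definition fps_monom (k : 'I_nu -> int) : F :=
  fun m => [forall i, (m i)%:Z == k i]%:R.

Definition fps_var (i : 'I_nu) : F := fps_monom (fun j => (i == j)%:Z).

Definition fps_deriv (i : 'I_nu) f : F :=
  fun m => f (m + U_(i))%MM *+ (m i).+1.

(* The vector field \sum_i X i * d/dx_i, as an operator. *)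
Definition vfield (X : 'I_nu -> F) f : F := \sum_i X i * fps_deriv i f.

Definition derivation (d : F -> F) : Prop :=
  linear d /\ forall f g, d (f * g) = d f * g + f * d g.

(* G is the sum of the operators T t, t in S: for every f, every coefficient
   of the family (T t f)_t has finite support, and these coefficients add up
   to that of G f. *)
Definition operator_sum (I : choiceType) (S : set I) (T : I -> F -> F)
    (G : F -> F) : Prop :=
  forall f m, finite_set [set t | S t /\ T t f m != 0] /\
    G f m = \sum_(t \in S) T t f m.

End FpsRing.

(* Absolute convergence on some polydisc centred at the origin. *)
Definition fps_convergent (nu : nat) (R : realType) (f : fps nu R[i]) : Prop :=
  exists2 r : R, 0 < r &
    summable [set: 'X_{1..nu}] (fun m => (Normc.normc (f m) * r ^+ mdeg m)%:E).

Section VectorFields.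
Variables (nu : nat) (R : realType).
Local Notation C := R[i].
Local Notation F := (fps nu C).

Definition linear_part (lam : 'I_nu -> C) : 'I_nu -> F :=
  fun i => lam i *: fps_var C i.

(* Local analytic vector field in prepared form, with spectrum lam. *)
Definition prepared_analytic (X : 'I_nu -> F) (lam : 'I_nu -> C) : Prop :=
  [/\ forall i, fps_convergent (X i),
      forall i, X i 0%MM = 0 &
      forall i j, X i U_(j)%MM = if i == j then lam i else 0].

Definition degree : Type := {ffun 'I_nu -> int}.
HB.instance Definition _ := Choice.on degree.

Definition admissible (n : degree) : Prop :=
  [/\ forall i, -1 <= n i,
      forall i j, n i = -1 -> n j = -1 -> i = j &
      1 <= \sum_i n i].

Definition homogeneous (n : degree) (d : F -> F) : Prop :=
  exists c : 'X_{1..nu} -> C, forall m : 'X_{1..nu},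
    d (fps_monom C (fun i => (m i)%:Z)) =
    c m *: fps_monom C (fun i => n i + (m i)%:Z).

(* Y = \sum_(n in A) D n is the decomposition of Y into non-zero homogeneous
   derivations; A and the D n (n in A) are determined by Y, and the values of
   D outside A are irrelevant. *)
Record homogeneous_decomposition (Y : F -> F) (A : set degree)
    (D : degree -> F -> F) : Prop := HomogeneousDecomposition {
  decomp_admissible : forall n, A n -> admissible n;
  decomp_derivation : forall n, A n -> derivation (D n);
  decomp_nonzero : forall n, A n -> exists f, D n f <> 0;
  decomp_homogeneous : forall n, A n -> homogeneous n (D n);
  decomp_sum : operator_sum A D Y
}.

Definition words (A : set degree) : set (seq degree) :=
  [set s : seq degree | forall n : degree, n \in s -> A n].

Definition word_op (D : degree -> F -> F) (s : seq degree) : F -> F :=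
  foldr (fun n T => D n \o T) id s.

Definition omega (lam : 'I_nu -> C) (n : degree) : C := \sum_i lam i *~ n i.

Definition omega_norm (lam : 'I_nu -> C) (s : seq degree) : C :=
  \sum_(n <- s) omega lam n.

Definition non_resonant (lam : 'I_nu -> C) (A : set degree) : Prop :=
  forall s, words A s -> s <> [::] -> omega_norm lam s <> 0.

(* The k-th factor, k < size s, is omega_1 + ... + omega_(k+1). *)
Definition Na_coef (lam : 'I_nu -> C) (s : seq degree) : C :=
  (\prod_(k < size s) omega_norm lam (take k.+1 s))^-1.

(* Na X Na^-1 = X_lin as operators; in particular Na is bijective. *)
Definition linearizes (X : 'I_nu -> F) (lam : 'I_nu -> C) (Na : F -> F) : Prop :=
  exists Nainv : F -> F, [/\ cancel Na Nainv, cancel Nainv Na &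
    vfield (linear_part lam) =1 Na \o vfield X \o Nainv].

End VectorFields.

(* Main.v *)
Require Import Defs.
From HB Require Import structures.
From mathcomp Require Import all_boot all_order all_algebra.
From mathcomp Require Import complex.
From mathcomp Require Import mpoly.
From mathcomp Require Import boolp classical_sets functions cardinality fsbigop.
From mathcomp Require Import reals ereal esum.
From mathcomp Require Import ring zify finmap.

Set Implicit Arguments.
Unset Strict Implicit.
Unset Printing Implicit Defensive.

Import Order.TTheory GRing.Theory Num.Theory.

Local Open Scope classical_set_scope.
Local Open Scope ring_scope.

(** Write L for the diagonal field and X = L + Y, where Y is the sum of the D_n.
Since L multiplies x^m by the linear form lambda . m, and D_n shifts exponents
by n, one has [L, D_n] = (n . lambda) D_n, hence
[L, D_s] = ||omega(s)|| D_s for every word s. The recursion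
Na^(s n) ||omega(s n)|| = Na^s, which is what non-resonance makes solvable, then
gives
  L Na - Na L = sum_s Na^s ||omega(s)|| D_s = (sum_s Na^s D_s) (sum_n D_n) = Na Y,
that is L Na = Na X (Na_op_intertwines). All these sums are finite coefficient
by coefficient: every letter raises the order by its total degree, which is at
least 1, and only finitely many words have a given total degree
(short_words_finite). For the same reason Na - 1 strictly raises the order, so
Na is bijective (Na_op_bijective).

It remains to see that Na is multiplicative. Instead of expanding into
shuffles of words, consider the defect E(f, g) = Na (f g) - Na f Na g. As L and
X are derivations and L Na = Na X,
  L E(f, g) = E(X f, g) + E(f, X g).
For f = x^p and g = x^q, the series E(x^p, x^q) only involves exponents m for
which m - p - q is the sum of the letters of a word s, and it has order greater
than |p| + |q|, so s is not empty. At such an exponent the identity reads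
  ||omega(s)|| E(x^p, x^q)_m = E(Y x^p, x^q)_m + E(x^p, Y x^q)_m,
where Y x^p and Y x^q have orders greater than |p| and |q|: an induction on
|m| - |p| - |q| shows that the defect vanishes (mult_defect_power). It vanishes
on all series because each of its coefficients depends on finitely many
coefficients of f and g.

The same reduction to monomials applies to the D_n themselves, which are only
known to be homogeneous on monomials, since a derivation of C[[x]] is
automatically continuous (derivation_ord). *)

(** * Formal power series and their order *)

Section LinearMaps.
Variables (K : nzRingType) (V W : lmodType K) (T : V -> W).
Hypothesis T_lin : linear T.
Let TL : {linear V -> W} := HB.pack T (GRing.isLinear.Build _ _ _ _ T T_lin).
Lemma linear_morphZ c v : T (c *: v) = c *: T v. Proof. exact: (linearZZ TL). Qed.
Lemma linear_morphD v w : T (v + w) = T v + T w. Proof. exact: (linearD TL). Qed.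
Lemma linear_morphB v w : T (v - w) = T v - T w. Proof. exact: (linearB TL). Qed.
Lemma linear_morph_sum (I : Type) (r : seq I) (P : pred I) (G : I -> V) :
  T (\sum_(i <- r | P i) G i) = \sum_(i <- r | P i) T (G i).
Proof. exact: (linear_sum TL). Qed.
End LinearMaps.

Section FormalPowerSeries.
Variables (nu : nat) (K : comNzRingType).
Local Notation F := (fps nu K).
Implicit Types (f g h : F) (m p q : 'X_{1..nu}).

Lemma fps_addE f g m : (f + g) m = f m + g m. Proof. by []. Qed.
Lemma fps_scaleE (c : K) f m : (c *: f) m = c * f m. Proof. by []. Qed.
Lemma fps_oppE f m : (- f) m = - f m. Proof. by []. Qed.

Lemma fps_sumE (I : Type) (r : seq I) (P : pred I) (G : I -> F) m :
  (\sum_(i <- r | P i) G i) m = \sum_(i <- r | P i) G i m.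
Proof. by apply: (big_morph (fun f : F => f m)). Qed.

Lemma fps_mul_coefE f g m : (f * g) m =
  \sum_(k : 'X_{1..nu < (mdeg m).+1} | (k <= m)%MM) f k * g (m - k)%MM.
Proof. by []. Qed.

Definition fps_power m : F := fps_monom K (fun i => (m i)%:Z).

Lemma fps_powerE p m : fps_power p m = (m == p)%:R.
Proof.
rewrite /fps_power /fps_monom; congr (_%:R); congr nat_of_bool.
apply/forallP/eqP => [e|-> i //]; apply/mnmP => i.
by have /eqP[] := e i.
Qed.

Lemma fps_power_mulE p f m :
  (fps_power p * f) m = if (p <= m)%MM then f (m - p)%MM else 0.
Proof.
rewrite fps_mul_coefE; case: ifP => [le_pm|nle].
  rewrite (bigD1 (BMultinom (mdeg_le_lt le_pm))) //= fps_powerE eqxx mul1r.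
  rewrite big1 ?addr0 // => k /andP[_]; rewrite bmeqP /= fps_powerE.
  by move=> /negbTE->; rewrite mul0r.
rewrite big1 // => k le_km; rewrite fps_powerE.
by case: eqP => [e|]; [rewrite e nle in le_km | rewrite mul0r].
Qed.

Lemma fps_powerD p q : fps_power (p + q)%MM = fps_power p * fps_power q.
Proof.
apply/funext => m; rewrite fps_power_mulE !fps_powerE.
case: ifP => le_pm.
  congr (_%:R); congr nat_of_bool.
  apply/eqP/eqP => [->|<-]; first by rewrite addmC addmK.
  by rewrite addmC submK.
by case: eqP => // e; rewrite e lem_addr in le_pm.
Qed.

Lemma fps_varE i : fps_var K i = fps_power U_(i)%MM.
Proof.
apply/funext => m; rewrite /fps_var /fps_power /fps_monom.
by congr (_%:R); congr nat_of_bool; apply: eq_forallb => j; rewrite mnmE.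
Qed.

Definition ord_ge (d : nat) f : Prop :=
  forall m, (mdeg m < d)%N -> f m = 0.

Lemma ord_geW d e f : (e <= d)%N -> ord_ge d f -> ord_ge e f.
Proof. by move=> le_ed fd m lt_me; apply: fd; apply: leq_trans le_ed. Qed.

Lemma ord_ge0 f : ord_ge 0 f. Proof. by []. Qed.

Lemma ord_geD d f g : ord_ge d f -> ord_ge d g -> ord_ge d (f + g).
Proof. by move=> fd gd m lt_md; rewrite fps_addE fd // gd // addr0. Qed.

Lemma ord_geN d f : ord_ge d f -> ord_ge d (- f).
Proof. by move=> fd m lt_md; rewrite fps_oppE fd // oppr0. Qed.

Lemma ord_geB d f g : ord_ge d f -> ord_ge d g -> ord_ge d (f - g).
Proof. by move=> fd /ord_geN; apply: ord_geD. Qed.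

Lemma ord_ge_sum d (I : Type) (r : seq I) (G : I -> F) :
  (forall i, ord_ge d (G i)) -> ord_ge d (\sum_(i <- r) G i).
Proof.
by move=> Gd m lt_md; rewrite fps_sumE big1 // => i _; apply: Gd.
Qed.

Lemma ord_geM d e f g : ord_ge d f -> ord_ge e g -> ord_ge (d + e) (f * g).
Proof.
move=> fd ge m lt_m; rewrite fps_mul_coefE big1 // => k le_km.
have [lt_kd|le_dk] := ltnP (mdeg k) d; first by rewrite fd ?mul0r.
rewrite ge ?mulr0 // -(ltn_add2r (mdeg k)) -mdegD submK //.
by rewrite (leq_trans lt_m) // addnC leq_add2l.
Qed.

Lemma ord_ge_power p : ord_ge (mdeg p) (fps_power p).
Proof.
by move=> m lt_mp; rewrite fps_powerE; case: eqP lt_mp => // ->; rewrite ltnn.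
Qed.

(** A linear functional that vanishes on series of high order is determined by
its values on monomials; this replaces continuity throughout. *)
Lemma linear_functional_expand (phi : F -> K) (M : nat) f :
  scalar phi -> (forall g, ord_ge M g -> phi g = 0) ->
  phi f = \sum_(k : 'X_{1..nu < M}) f k * phi (fps_power k).
Proof.
move=> phi_lin phi0.
pose phiL : {scalar F} := HB.pack phi (GRing.isLinear.Build _ _ _ _ phi phi_lin).
pose t := \sum_(k : 'X_{1..nu < M}) f k *: fps_power k.
have : phiL (f - t) = 0.
  apply: phi0 => m lt_mM; rewrite fps_addE fps_oppE /t fps_sumE.
  rewrite (bigD1 (BMultinom lt_mM)) //= fps_scaleE fps_powerE eqxx mulr1.
  rewrite big1 ?addr0 ?subrr // => k; rewrite bmeqP /= eq_sym => /negbTE ne.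
  by rewrite fps_scaleE fps_powerE ne mulr0.
rewrite linearB => /eqP; rewrite subr_eq0 => /eqP e.
apply: etrans e _; rewrite linear_sum; apply: eq_bigr => k _.
by rewrite linearZ.
Qed.

Lemma functional_eq0 (phi : F -> K) (M : nat) f :
  scalar phi -> (forall g, ord_ge M g -> phi g = 0) ->
  (forall p, f p != 0 -> phi (fps_power p) = 0) -> phi f = 0.
Proof.
move=> phi_lin phi0 phip; rewrite (linear_functional_expand f phi_lin phi0).
apply: big1 => k _; have [->|/phip->] := eqVneq (f k) 0; first by rewrite mul0r.
by rewrite mulr0.
Qed.

(** Each monomial other than 1 is divisible by a variable; collecting the
monomials according to one such variable exhibits a series without constant
term as a combination of the variables. *)
Lemma ord_geS_decomp d f : ord_ge d.+1 f ->
  exists2 g : 'I_nu -> F, f = \sum_i fps_power U_(i)%MM * g i &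
    forall i, ord_ge d (g i).
Proof.
move=> fd; pose first_var m := [pick j | m j != 0%N].
exists (fun i m => if first_var (m + U_(i))%MM == Some i
                   then f (m + U_(i))%MM else 0); last first.
  by move=> i m lt_md; case: ifP => // _; rewrite fd // mdegD mdeg1 addn1.
apply/funext => m; rewrite fps_sumE.
transitivity (\sum_i if first_var m == Some i then f m else 0).
  rewrite /first_var; case: pickP => [j _|m0].
    rewrite (bigD1 j) //= eqxx big1 ?addr0 // => i /negbTE ne.
    by rewrite (inj_eq Some_inj) eq_sym ne.
  rewrite big1 // fd //; suff -> : m = 0%MM by rewrite mdeg0.
  by apply/mnmP => i; rewrite mnm0E; apply/eqP/negPn; rewrite m0.
apply: eq_bigr => i _; rewrite fps_power_mulE lep1mP.
case: (eqVneq (m i) 0%N) => [mi0|mi0] /=.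
  rewrite /first_var; case: pickP => [j mj|//] /=.
  by case: eqP => // -[e]; rewrite e mi0 in mj.
by rewrite submK // lep1mP.
Qed.

(** Automatic continuity: writing a series of order above [k] as a sum of
products x_i g_i with g_i of order at least [k], the Leibniz rule leaves
d(x_i) g_i and x_i d(g_i), and induction applies to the latter. *)
Lemma derivation_ord (d : F -> F) k f :
  derivation d -> ord_ge k.+1 f -> ord_ge k (d f).
Proof.
move=> [d_lin dM].
elim: k f => [//|k IH] f /ord_geS_decomp[g -> gk].
rewrite (linear_morph_sum d_lin); apply: ord_ge_sum => i /=; rewrite dM.
apply: ord_geD; first exact: (ord_geM (@ord_ge0 _)).
apply: (@ord_geM 1); last exact: IH.
by have := @ord_ge_power U_(i)%MM; rewrite mdeg1.
Qed.

Lemma fps_deriv_linear i : linear (@fps_deriv nu K i).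
Proof.
move=> c f g; apply/funext => m; rewrite fps_addE fps_scaleE /fps_deriv.
by rewrite fps_addE fps_scaleE mulrnDl mulrnAr.
Qed.

(** Both sides only see finitely many coefficients, so the Leibniz rule for
polynomials applies to truncations. *)
Lemma fps_derivM i f g :
  fps_deriv i (f * g) = fps_deriv i f * g + f * fps_deriv i g.
Proof.
apply/funext => m; set e := (m + U_(i))%MM; pose d := (mdeg e).+1.
have T (u : F) k : (k <= e)%MM -> (fps_trunc d u)@_k = u k.
  by move=> /mdeg_le_lt lt_kd; rewrite mcoeff_trunc.
have le_e k : (k <= m)%MM -> (k <= e)%MM.
  by move=> /lepm_trans; apply; rewrite lem_addr.
have le_eS k : (k <= m)%MM -> (k + U_(i) <= e)%MM.
  by move=> /mnm_lepP le_km; apply/mnm_lepP => j; rewrite !mnmDE leq_add2r.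
have T' (u : F) k : (k <= m)%MM -> ((fps_trunc d u)^`M(i))@_k = fps_deriv i u k.
  by move=> /le_eS le_ke; rewrite mcoeff_deriv T.
have T0 (u : F) k : (k <= m)%MM -> (fps_trunc d u)@_k = u k by move=> /le_e/T.
transitivity ((fps_trunc d f * fps_trunc d g)^`M(i)@_m).
  by rewrite mcoeff_deriv /fps_deriv -(fps_mulE (T f) (T g)).
rewrite mderivM mcoeffD fps_addE.
by rewrite -(fps_mulE (T' f) (T0 g)) -(fps_mulE (T0 f) (T' g)).
Qed.

Lemma vfield_derivation (X : 'I_nu -> F) : derivation (vfield X).
Proof.
split=> [c f g|f g]; rewrite /vfield.
  rewrite scaler_sumr -big_split; apply: eq_bigr => i _ /=.
  by rewrite fps_deriv_linear mulrDr scalerAr.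
rewrite mulr_suml mulr_sumr -big_split; apply: eq_bigr => i _ /=.
by rewrite fps_derivM mulrDr mulrA mulrCA.
Qed.

(** The equation f + T f = g is solved by the iteration f := g - T f: each round
settles one more degree, because [T] strictly raises the order. *)
Lemma unipotent_bijective (T : F -> F) : linear T ->
  (forall d f, ord_ge d f -> ord_ge d.+1 (T f)) ->
  bijective (fun f => f + T f).
Proof.
move=> T_lin T_ord.
have TB f g : T (f - g) = T f - T g by rewrite (linear_morphB T_lin).
(* The coefficients of degree below k of approx g k are final. *)
pose approx g := fix approx k := if k is k'.+1 then g - T (approx k') else 0.
have approxS g k : ord_ge k (approx g k.+1 - approx g k).
  elim: k => [//|k IH] /=; rewrite opprB addrC addrA subrK.
  by rewrite -opprB -TB; apply/ord_geN/T_ord.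
have approx_ge g k l : (k <= l)%N -> ord_ge k (approx g l - approx g k).
  move=> /subnK<-; elim: (l - k)%N => [|j IH]; first by rewrite subrr => m.
  rewrite addSn -(subrK (approx g (j + k)) (approx g _.+1)) -addrA.
  by apply: ord_geD => //; apply: (ord_geW (leq_addl j k)).
pose sol g : F := fun m => approx g (mdeg m).+1 m.
have sol_approx g k : ord_ge k (sol g - approx g k).
  move=> m lt_mk; have := approx_ge g _ _ lt_mk m (ltnSn _).
  rewrite !fps_addE !fps_oppE /sol => /eqP.
  by rewrite subr_eq0 => /eqP->; rewrite subrr.
have solK g : sol g + T (sol g) = g.
  apply/funext => m; have := T_ord _ _ (sol_approx g (mdeg m)) m (ltnSn _).
  rewrite TB fps_addE fps_oppE => /eqP; rewrite subr_eq0 => /eqP e.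
  by rewrite fps_addE e /sol /= fps_addE fps_oppE subrK.
have ker0 f : f + T f = 0 -> f = 0.
  move=> e; have fk k : ord_ge k f.
    elim: k => [//|k /T_ord/ord_geN].
    by rewrite (_ : - T f = f) //; apply/esym/eqP; rewrite -addr_eq0 e.
  by apply/funext => m; apply: (fk (mdeg m).+1).
exists sol => // f; apply/eqP; rewrite -subr_eq0; apply/eqP/ker0.
by rewrite TB addrACA -opprD solK subrr.
Qed.

End FormalPowerSeries.

(** * The diagonal field and homogeneous derivations *)

Section Perturbation.
Variables (nu : nat) (R : realType).
Local Notation C := R[i].
Local Notation F := (fps nu C).
Implicit Types (f g h : F) (m p q : 'X_{1..nu}) (n : degree nu).

Section LinearPart.
Variable lam : 'I_nu -> C.

Definition eigenvalue m : C := \sum_i lam i *+ m i.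

Lemma eigenvalueD p q : eigenvalue (p + q)%MM = eigenvalue p + eigenvalue q.
Proof.
by rewrite /eigenvalue -big_split; apply: eq_bigr => i _; rewrite mnmDE mulrnDr.
Qed.

Lemma linear_part_coef f m :
  vfield (linear_part lam) f m = eigenvalue m * f m.
Proof.
rewrite /vfield fps_sumE mulr_suml; apply: eq_bigr => i _.
rewrite /linear_part -scalerAl fps_scaleE fps_varE fps_power_mulE lep1mP.
have [->|mi0] := eqVneq (m i) 0%N; first by rewrite mulr0 mul0r.
rewrite /= /fps_deriv submK ?lep1mP // mnmBE mnm1E eqxx subn1 prednK ?lt0n //.
by rewrite mulrnAr mulrnAl.
Qed.

Lemma linear_part_ord d f : ord_ge d f -> ord_ge d (vfield (linear_part lam) f).
Proof. by move=> fd m /fd fm0; rewrite linear_part_coef fm0 mulr0. Qed.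

Lemma linear_part_power p :
  vfield (linear_part lam) (fps_power C p) = eigenvalue p *: fps_power C p.
Proof.
apply/funext => m; rewrite linear_part_coef fps_scaleE fps_powerE.
by case: eqP => [->|]; rewrite ?mulr0.
Qed.

End LinearPart.

(** The identity m = n + q between exponents, stated in integers since [n] may
have a negative entry. *)
Definition shifted n q m : Prop := forall i, (m i)%:Z = n i + (q i)%:Z.

(** The sum of the entries, as a natural number; it is positive for admissible
degrees. *)
Definition tdeg n : nat := absz (\sum_i n i).

Lemma tdegE n : admissible n -> (tdeg n)%:Z = \sum_i n i.
Proof. by case=> _ _ n1; rewrite /tdeg gez0_abs // (le_trans _ n1). Qed.

Lemma tdeg_gt0 n : admissible n -> (0 < tdeg n)%N.
Proof.
move=> n_adm; have [_ _] := n_adm.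
by rewrite -tdegE.
Qed.

Lemma mdeg_shifted n q m : admissible n -> shifted n q m ->
  mdeg m = (tdeg n + mdeg q)%N.
Proof.
move=> n_adm e; apply/eqP; rewrite -eqz_nat PoszD tdegE // !mdegE.
rewrite !(big_morph Posz PoszD (erefl _)) -big_split; apply/eqP.
by apply: eq_bigr => i _; rewrite e.
Qed.

Lemma eigenvalue_shifted lam n q m : shifted n q m ->
  eigenvalue lam m = omega lam n + eigenvalue lam q.
Proof.
move=> e; rewrite /eigenvalue /omega -big_split; apply: eq_bigr => i _ /=.
by rewrite !pmulrn e mulrzDr.
Qed.

Section Homogeneous.
Variables (n : degree nu) (d : F -> F).
Hypotheses (d_der : derivation d) (d_hom : homogeneous n d).

Lemma derivation_coef_scalar m : scalar (fun f => d f m).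
Proof. by case: d_der => d_lin _ c f g; rewrite d_lin. Qed.

Lemma derivation_coef_eq0 m g : ord_ge (mdeg m).+2 g -> d g m = 0.
Proof. by move=> /(derivation_ord d_der); apply. Qed.

Lemma homogeneous_power p m :
  d (fps_power C p) m != 0 -> shifted n p m.
Proof.
have [c dE] := d_hom; rewrite dE fps_scaleE /fps_monom.
by case: forallP => [e _ i|_]; [apply/eqP/e | rewrite mulr0 eqxx].
Qed.

(** Homogeneity is given on monomials only; it passes to series because a
coefficient of [d f] depends on finitely many coefficients of [f]. *)
Lemma homogeneous_support f m :
  d f m != 0 -> exists2 q, f q != 0 & shifted n q m.
Proof.
move=> /eqP dfm; apply: contrapT => noq; apply: dfm.
apply: (functional_eq0 (phi := fun g => d g m) (derivation_coef_scalar m)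
  (@derivation_coef_eq0 m)) => p fp.
apply/eqP/negPn/negP => /homogeneous_power e.
by apply: noq; exists p.
Qed.

(** On monomials, [d] shifts exponents by [n] and thus shifts the eigenvalue of
the diagonal field by [omega lam n]. *)
Lemma homogeneous_commutator lam f :
  vfield (linear_part lam) (d f) =
  d (vfield (linear_part lam) f) + omega lam n *: d f.
Proof.
have [L_lin _] := vfield_derivation (linear_part lam).
have [d_lin _] := d_der.
apply/funext => m; rewrite linear_part_coef fps_addE fps_scaleE.
pose phi g := eigenvalue lam m * d g m
  - (d (vfield (linear_part lam) g) m + omega lam n * d g m).
suff : phi f = 0 by move=> /eqP; rewrite subr_eq0 => /eqP.
apply: (functional_eq0 (M := (mdeg m).+2)).
- move=> c g h; rewrite /phi L_lin !d_lin !fps_addE !fps_scaleE; ring.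
- move=> g gm; rewrite /phi !derivation_coef_eq0 //; last exact: linear_part_ord.
  by rewrite !mulr0 addr0 subr0.
- move=> p _; rewrite /phi linear_part_power (linear_morphZ d_lin) fps_scaleE.
  have [->|/homogeneous_power e] := eqVneq (d (fps_power C p) m) 0.
    by rewrite !mulr0 addr0 subr0.
  by rewrite (eigenvalue_shifted _ e); ring.
Qed.

End Homogeneous.

End Perturbation.

(** * Words of degrees and their operators *)

Section Linearization.
Variables (nu : nat) (R : realType).
Local Notation C := R[i].
Local Notation F := (fps nu C).
Implicit Types (f g h : F) (m p q : 'X_{1..nu}) (n : degree nu).
Implicit Types s t : seq (degree nu).
Variables (lam : 'I_nu -> C) (A : set (degree nu)) (D : degree nu -> F -> F).
Variable X : 'I_nu -> F.
Hypothesis X_dec : homogeneous_decomposition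
  (fun f => vfield X f - vfield (linear_part lam) f) A D.
Hypothesis X_nonres : non_resonant lam A.
Local Notation L := (vfield (linear_part lam)).
Local Notation Y := (fun f => vfield X f - L f).
Local Notation c := (Na_coef lam).

Let A_adm := decomp_admissible X_dec.
Let D_der := decomp_derivation X_dec.
Let D_hom := decomp_homogeneous X_dec.

Definition word_tdeg s : nat := \sum_(n <- s) tdeg n.

Lemma words_cons n s : words A (n :: s) <-> A n /\ words A s.
Proof.
split=> [As|[An As] k].
  by split=> [|k ks]; apply: As; rewrite inE ?eqxx ?ks ?orbT.
by rewrite inE => /orP[/eqP->|/As].
Qed.

Lemma words_cat s t : words A s -> words A t -> words A (s ++ t).
Proof. by move=> As At n; rewrite mem_cat => /orP[/As|/At]. Qed.

Lemma words_rcons s n : words A (rcons s n) <-> words A s /\ A n.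
Proof.
split=> [As|[As An]].
  by split=> [k ks|]; apply: As; rewrite mem_rcons inE ?eqxx ?ks ?orbT.
by move=> k; rewrite mem_rcons inE => /orP[/eqP->|/As].
Qed.

Lemma word_tdeg_cons n s : word_tdeg (n :: s) = (tdeg n + word_tdeg s)%N.
Proof. by rewrite /word_tdeg big_cons. Qed.

Lemma word_tdeg_rcons n s : word_tdeg (rcons s n) = (word_tdeg s + tdeg n)%N.
Proof. by rewrite /word_tdeg -cats1 big_cat big_seq1. Qed.

Lemma word_tdeg_size s : words A s -> (size s <= word_tdeg s)%N.
Proof.
elim: s => [//|n s IH] /words_cons[/A_adm/tdeg_gt0 n0 /IH le_s].
by rewrite word_tdeg_cons /= -add1n leq_add.
Qed.

(** Entries are at least -1 and their sum is at most [M], so every entry lies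
between -1 and M + nu. *)
Lemma tdeg_finite M : finite_set [set n | A n /\ (tdeg n <= M)%N].
Proof.
pose u (g : {ffun 'I_nu -> 'I_(M + nu + 2)}) : degree nu :=
  [ffun i => (g i : nat)%:Z - 1].
apply: (@sub_finite_set _ _ [set u g | g in [set: {ffun 'I_nu -> 'I_(M + nu + 2)}]]);
  last exact/finite_image/finite_finset.
move=> n [/A_adm n_adm le_nM] /=; have [n_ge _ _] := n_adm.
have n1_ge i : 0 <= n i + 1 by rewrite -lerBlDr.
have lt_n i : (absz (n i + 1)%R < M + nu + 2)%N.
  have le1 : n i + 1 <= \sum_j (n j + 1).
    by rewrite (bigD1 i) //= lerDl sumr_ge0.
  rewrite addn2 ltnS leqW // -lez_nat gez0_abs // (le_trans le1) //.
  rewrite big_split /= -tdegE // PoszD lerD //.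
  by rewrite sumr_const card_ord -natz.
exists [ffun i => Ordinal (lt_n i)] => //.
by apply/ffunP => i; rewrite !ffunE /= gez0_abs // addrK.
Qed.

Definition short_words M : set (seq (degree nu)) :=
  [set s | words A s /\ (word_tdeg s <= M)%N].

(** A letter has total degree at least 1, so a word of total degree at most [M]
has at most [M] letters, taken from a finite alphabet. *)
Lemma short_words_finite M : finite_set (short_words M).
Proof.
pose Q := [set n | A n /\ (tdeg n <= M)%N].
have bounded k : finite_set [set s | short_words M s /\ (size s <= k)%N].
  elim: k => [|k IH].
    by apply: (sub_finite_set _ (finite_set1 [::])) => s [_]; case: s.
  pose T := [set s | short_words M s /\ (size s <= k)%N].
  have fin : finite_set ([set [::]] `|` [set p.1 :: p.2 | p in Q `*` T]).
    rewrite finite_setU; split; first exact: finite_set1.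
    by apply: finite_image; apply: finite_setX => //; apply: tdeg_finite.
  apply: sub_finite_set fin => -[|n s] [[As le_M] le_k]; [by left|right].
  move: As le_M le_k => /words_cons[An As]; rewrite word_tdeg_cons ltnS => le_M le_k.
  exists (n, s) => //; split; split=> //=.
  - exact: leq_trans (leq_addr _ _) le_M.
  - by split=> //; apply: leq_trans (leq_addl _ _) le_M.
apply: sub_finite_set (bounded M) => s [As le_M]; split=> //.
exact: leq_trans (word_tdeg_size As) le_M.
Qed.

Lemma word_op_linear s : words A s -> linear (word_op D s).
Proof.
elim: s => [//|n s IH] /words_cons[/D_der[D_lin _] /IH IHs] a f g /=.
by rewrite IHs D_lin.
Qed.

Lemma word_op_rcons s n f : word_op D (rcons s n) f = word_op D s (D n f).
Proof. by elim: s => //= k s ->. Qed.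

(** The word shifts exponents by the sum of its letters; of this shift, only
the total degree and the eigenvalue are recorded. *)
Lemma word_op_support s f m : words A s -> word_op D s f m != 0 ->
  exists q, [/\ f q != 0, mdeg m = (word_tdeg s + mdeg q)%N &
    eigenvalue lam m = omega_norm lam s + eigenvalue lam q].
Proof.
elim: s m => [|n s IH] m.
  move=> _ fm; exists m; split=> //; first by rewrite /word_tdeg big_nil.
  by rewrite /omega_norm big_nil add0r.
move=> /words_cons[An As] /(homogeneous_support (D_der An) (D_hom An)).
case=> k /(IH _ As)[q [fq kdeg keig]] mk; exists q; split=> //.
  by rewrite (mdeg_shifted (A_adm An) mk) kdeg word_tdeg_cons addnA.
by rewrite (eigenvalue_shifted lam mk) keig /omega_norm big_cons addrA.
Qed.

Lemma word_op_ord s d f : words A s -> ord_ge d f ->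
  ord_ge (word_tdeg s + d) (word_op D s f).
Proof.
move=> As fd m lt_m; apply/eqP/negPn/negP => /(word_op_support As)[q [fq e _]].
by move: lt_m; rewrite e ltn_add2l => /fd fq0; rewrite fq0 eqxx in fq.
Qed.

Lemma word_op_long s f m : words A s -> (mdeg m < word_tdeg s)%N ->
  word_op D s f m = 0.
Proof.
by move=> As lt_m; apply: (word_op_ord As (@ord_ge0 _ _ f)); rewrite addn0.
Qed.

Lemma word_op_commutator s f : words A s ->
  L (word_op D s f) = word_op D s (L f) + omega_norm lam s *: word_op D s f.
Proof.
elim: s f => [|n s IH] f As; first by rewrite /omega_norm big_nil scale0r addr0.
move: As => /words_cons[An As] /=.
rewrite (homogeneous_commutator (D_der An) (D_hom An)) (IH _ As).
have [D_lin _] := D_der An.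
rewrite (linear_morphD D_lin) (linear_morphZ D_lin) /omega_norm big_cons.
by rewrite [omega lam n + _]addrC scalerDl addrA.
Qed.

(** * The operator Na intertwines the field and its linear part *)

Lemma Na_coef_nil : c [::] = 1.
Proof. by rewrite /Na_coef big_ord0 invr1. Qed.

(** The last factor of the denominator of [c (rcons s n)] is the norm of the
whole word. This is the only property of the coefficients used below, besides
the value 1 on the empty word. *)
Lemma Na_coef_rcons s n : words A (rcons s n) ->
  c (rcons s n) * omega_norm lam (rcons s n) = c s.
Proof.
move=> Asn; have nz : omega_norm lam (rcons s n) != 0.
  by apply/eqP/(X_nonres Asn); case: (s).
rewrite /Na_coef size_rcons big_ord_recr /= take_oversize ?size_rcons //.
rewrite invfM divfK //; congr (_^-1); apply: eq_bigr => k _.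
by rewrite -cats1 takel_cat.
Qed.

Definition Na_op f : F :=
  fun m => \sum_(s \in words A) (c s *: word_op D s f) m.

Lemma fsum_short_words (G : seq (degree nu) -> C) M :
  (forall s, words A s -> (M < word_tdeg s)%N -> G s = 0) ->
  \sum_(s \in words A) G s = \sum_(s \in short_words M) G s.
Proof.
move=> G0; apply/esym/fsbig_widen => [s []//|s [As nW]] /=; apply: G0 => //.
by rewrite ltnNge; apply/negP => le_M; apply: nW.
Qed.

Lemma Na_op_short M f m : (mdeg m <= M)%N ->
  Na_op f m = \sum_(s \in short_words M) c s * word_op D s f m.
Proof.
move=> le_mM; rewrite /Na_op (@fsum_short_words _ M) // => s As lt_M.
by rewrite fps_scaleE word_op_long ?mulr0 // (leq_ltn_trans le_mM).
Qed.

Lemma Na_op_linear : linear Na_op.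
Proof.
move=> a f g; apply/funext => m; rewrite fps_addE fps_scaleE.
rewrite !(Na_op_short _ (leqnn _)) mulr_fsumr -fsbig_split /=; last first.
  exact: short_words_finite.
apply: eq_fsbigr => s /set_mem[As _].
by rewrite (word_op_linear As) fps_addE fps_scaleE mulrDr mulrCA.
Qed.

Lemma Na_op_sub_id_ord d f : ord_ge d f -> ord_ge d.+1 (Na_op f - f).
Proof.
move=> fd m; rewrite ltnS => le_md; rewrite fps_addE fps_oppE /Na_op.
rewrite -(@fsbig_widen _ _ _ _ [set [::]]) ?fsbig_set1.
- by rewrite Na_coef_nil scale1r subrr.
- by move=> s ->.
- move=> s [As s_nil] /=; rewrite fps_scaleE (word_op_ord As fd) ?mulr0 //.
  rewrite (leq_ltn_trans le_md) // -[ltnLHS]add0n ltn_add2r.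
  by rewrite (leq_trans _ (word_tdeg_size As)) //; case: s {As} s_nil => [[]|].
Qed.

Lemma Na_op_ord d f : ord_ge d f -> ord_ge d (Na_op f).
Proof.
move=> fd; rewrite -(subrK f (Na_op f)); apply: ord_geD => //.
exact: ord_geW (Na_op_sub_id_ord fd).
Qed.

Lemma Na_op_support f m : Na_op f m != 0 -> exists2 s, words A s &
  exists q, [/\ f q != 0, mdeg m = (word_tdeg s + mdeg q)%N &
    eigenvalue lam m = omega_norm lam s + eigenvalue lam q].
Proof.
move=> /eqP nz; apply: contrapT => none; apply: nz.
apply: fsbig1 => s As; rewrite fps_scaleE.
have [->|/(word_op_support As) supp] := eqVneq (word_op D s f m) 0.
  by rewrite mulr0.
by case: none; exists s.
Qed.

(** Only degrees of total degree at most [M] contribute to coefficients of degree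
at most [M], so [Y f] is a finite sum up to high order; operators of words, being
linear and never lowering orders, can then be applied term by term. *)
Lemma perturbation_short M f : ord_ge M.+1
  (Y f - \sum_(n <- fset_set [set n | A n /\ (tdeg n <= M)%N]) D n f).
Proof.
move=> m; rewrite ltnS => le_mM; rewrite fps_addE fps_oppE fps_sumE.
have [_ ->] := decomp_sum X_dec f m.
rewrite -fsbig_finite /=; last exact: tdeg_finite.
rewrite (@fsbig_widen _ _ _ _ [set n | A n /\ (tdeg n <= M)%N] A) ?subrr //.
  by move=> n [].
move=> n [An nQ] /=; have As : words A [:: n] by apply/words_cons.
apply: (@word_op_long [:: n]) => //; rewrite /word_tdeg big_seq1.
by rewrite (leq_ltn_trans le_mM) // ltnNge; apply/negP => ?; apply: nQ.
Qed.

Lemma word_op_perturbation M s f m : words A s -> (mdeg m <= M)%N ->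
  word_op D s (Y f) m =
  \sum_(n \in [set n | A n /\ (tdeg n <= M)%N]) word_op D (rcons s n) f m.
Proof.
move=> As le_mM; rewrite fsbig_finite; last exact: tdeg_finite.
have := word_op_ord As (@perturbation_short M f) (m := m).
rewrite (linear_morphB (word_op_linear As)) ltn_addl // => /(_ isT).
rewrite fps_addE fps_oppE => /eqP; rewrite subr_eq0 => /eqP->.
rewrite (linear_morph_sum (word_op_linear As)) fps_sumE.
by apply: eq_bigr => n _; rewrite word_op_rcons.
Qed.

(** Appending a letter is a bijection from pairs (word, letter) to non-empty
words; the empty word contributes nothing to the right-hand side because its
norm is zero. *)
Lemma Na_op_perturbation f m : Na_op (Y f) m =
  \sum_(s \in words A) c s * omega_norm lam s * word_op D s f m.
Proof.
pose Q := [set n | A n /\ (tdeg n <= mdeg m)%N]; pose W := short_words (mdeg m).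
pose G s := c s * omega_norm lam s * word_op D s f m.
have Wfin : finite_set W by apply: short_words_finite.
have Qfin : finite_set Q by apply: tdeg_finite.
rewrite (Na_op_short _ (leqnn _)).
transitivity (\sum_(s \in W) \sum_(n \in Q) G (rcons s n)).
  apply: eq_fsbigr => s /set_mem[As _].
  rewrite (word_op_perturbation _ As (leqnn _)) mulr_fsumr.
  apply: eq_fsbigr => n /set_mem[An _].
  by rewrite /G Na_coef_rcons //; apply/words_rcons.
(* The pairs in W x Q give all non-empty words of total degree at most mdeg m,
   and some longer ones, whose operators vanish at m. *)
rewrite pair_fsbig //; pose rc (p : seq (degree nu) * degree nu) := rcons p.1 p.2.
transitivity (\sum_(s \in rc @` (W `*` Q)) G s).
  apply/esym/fsbig_image => -[s n] [t k] _ _ /rcons_inj[-> ->] //.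
apply: fsbig_widen => [_ [[s n] [[As _] [An _]] <-]|s [As nim]] /=.
  by apply/words_rcons.
have [e|s_long] := leqP (word_tdeg s) (mdeg m); last first.
  by rewrite /G word_op_long ?mulr0.
case/lastP: s => [|s n] in As nim e *.
  by rewrite /G /omega_norm big_nil mulr0 mul0r.
case: nim; exists (s, n) => //; move: As e => /words_rcons[As An].
rewrite word_tdeg_rcons => e; split; split => //=.
  exact: leq_trans (leq_addr _ _) e.
exact: leq_trans (leq_addl _ _) e.
Qed.

Lemma Na_op_intertwines f : L (Na_op f) = Na_op (vfield X f).
Proof.
have -> : vfield X f = L f + Y f by rewrite addrC subrK.
rewrite (linear_morphD Na_op_linear); apply/funext => m.
rewrite fps_addE Na_op_perturbation linear_part_coef !(Na_op_short _ (leqnn _)).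
rewrite (@fsum_short_words _ (mdeg m)); last first.
  by move=> s As lt_m; rewrite word_op_long ?mulr0.
rewrite mulr_fsumr -fsbig_split /=; last exact: short_words_finite.
apply: eq_fsbigr => s /set_mem[As _]; rewrite mulrCA -linear_part_coef.
by rewrite word_op_commutator // fps_addE fps_scaleE mulrDr mulrA.
Qed.

(** * Na is multiplicative *)

Definition mult_defect f g : F := Na_op (f * g) - Na_op f * Na_op g.

Lemma mult_defectC f g : mult_defect f g = mult_defect g f.
Proof. by rewrite /mult_defect mulrC [Na_op f * _]mulrC. Qed.

Lemma mult_defect_linear g : linear (mult_defect g).
Proof.
move=> a f h; rewrite /mult_defect mulrDr -scalerAr !Na_op_linear mulrDr -scalerAr.
by rewrite scalerBr opprD addrACA.
Qed.

(** With Na = 1 + k, the terms f g cancel in the defect, and every remaining term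
contains k, which strictly raises the order. *)
Lemma mult_defect_ord d e f g : ord_ge d f -> ord_ge e g ->
  ord_ge (d + e).+1 (mult_defect f g).
Proof.
move=> fd ge; pose k h := Na_op h - h.
have -> : mult_defect f g = k (f * g) - k f * g - Na_op f * k g.
  by rewrite /mult_defect /k; ring.
apply: ord_geB; first apply: ord_geB.
- exact/Na_op_sub_id_ord/ord_geM.
- by rewrite -addSn; apply: ord_geM => //; apply: Na_op_sub_id_ord.
- by rewrite -addnS; apply: ord_geM; [exact: Na_op_ord|apply: Na_op_sub_id_ord].
Qed.

Lemma mult_defect_derivation f g :
  L (mult_defect f g) = mult_defect (vfield X f) g + mult_defect f (vfield X g).
Proof.
have [L_lin LM] := vfield_derivation (linear_part lam).
have [X_lin XM] := vfield_derivation X.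
rewrite /mult_defect (linear_morphB L_lin) LM !Na_op_intertwines XM.
by rewrite (linear_morphD Na_op_linear); ring.
Qed.

(** Both Na (x^p x^q) and Na x^p Na x^q are supported on the translate of the
semigroup generated by [A] by p + q; concatenating words gives the second case. *)
Lemma mult_defect_power_support p q m :
  mult_defect (fps_power C p) (fps_power C q) m != 0 ->
  exists2 s, words A s & mdeg m = (word_tdeg s + mdeg (p + q)%MM)%N /\
    eigenvalue lam m = omega_norm lam s + eigenvalue lam (p + q)%MM.
Proof.
have power_neq0 r k : fps_power C r k != 0 -> k = r.
  by rewrite fps_powerE; have [|_] := eqVneq k r; rewrite /= ?eqxx.
rewrite /mult_defect -fps_powerD fps_addE fps_oppE.
have [->|/Na_op_support[s As [k [/power_neq0-> e1 e2]]] _] :=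
  eqVneq (Na_op (fps_power C (p + q)%MM) m) 0; last by exists s.
rewrite sub0r oppr_eq0 => nz.
have [k [le_km pk qk]] : exists k, [/\ (k <= m)%MM,
    Na_op (fps_power C p) k != 0 & Na_op (fps_power C q) (m - k)%MM != 0].
  apply: contrapT => none; case/eqP: nz; rewrite fps_mul_coefE.
  apply: big1 => k le_km.
  have [->|pk] := eqVneq (Na_op (fps_power C p) k) 0; first by rewrite mul0r.
  have [->|qk] := eqVneq (Na_op (fps_power C q) (m - k)%MM) 0.
    by rewrite mulr0.
  by case: none; exists k.
have [s As [k1 [/power_neq0-> s1 s2]]] := Na_op_support pk.
have [t At [k2 [/power_neq0-> t1 t2]]] := Na_op_support qk.
exists (s ++ t); first exact: words_cat.
rewrite -(submK le_km) !mdegD !eigenvalueD s1 s2 t1 t2.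
by rewrite /word_tdeg /omega_norm !big_cat /=; split; [lia|ring].
Qed.

Lemma perturbation_ord d f : ord_ge d f -> ord_ge d.+1 (Y f).
Proof.
move=> fd m; rewrite ltnS => le_md; have [_ ->] := decomp_sum X_dec f m.
apply: fsbig1 => n An; have As : words A [:: n] by apply/words_cons.
apply: (word_op_ord As fd); rewrite (leq_ltn_trans le_md) //.
by rewrite -[ltnLHS]add0n ltn_add2r /word_tdeg big_seq1 tdeg_gt0 //; apply: A_adm.
Qed.

(** Induction on the excess [j] of [mdeg m] over [mdeg p + mdeg q]. If the
coefficient were non-zero, its exponent would come from a non-empty word, whose
norm is non-zero by non-resonance, while the derivation identity forces the
product of this norm and the coefficient to vanish. *)
Lemma mult_defect_power p q m :
  mult_defect (fps_power C p) (fps_power C q) m = 0.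
Proof.
have by_order : forall p q, (mdeg m <= mdeg p + mdeg q)%N ->
    mult_defect (fps_power C p) (fps_power C q) m = 0.
  move=> p' q' le_m.
  exact: (mult_defect_ord (@ord_ge_power _ _ _) (@ord_ge_power _ _ _)).
suff main j : forall p q, (mdeg m <= mdeg p + mdeg q + j)%N ->
    mult_defect (fps_power C p) (fps_power C q) m = 0.
  by apply: (main (mdeg m)); rewrite leq_addl.
elim: j => [|j IH] {}p {}q; first by rewrite addn0; apply: by_order.
move=> le_m; have [|lt_m] := leqP (mdeg m) (mdeg p + mdeg q); first exact: by_order.
(* The monomials of Y x^b have degree above mdeg b, so the induction hypothesis
   covers each of them. *)
have step a b : (mdeg a + mdeg b = mdeg p + mdeg q)%N ->
    mult_defect (fps_power C a) (Y (fps_power C b)) m = 0.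
  move=> eab; pose phi g := mult_defect (fps_power C a) g m.
  apply: (functional_eq0 (phi := phi) (M := (mdeg m).+1)).
  - by move=> x g h; rewrite /phi mult_defect_linear.
  - move=> g gm; apply: (mult_defect_ord (@ord_ge0 _ _ _) gm).
    by rewrite add0n ltnW.
  - move=> r Yr; apply: IH.
    suff : (mdeg b < mdeg r)%N by lia.
    rewrite ltnNge; apply/negP => le_rb; case/eqP: Yr.
    exact: (perturbation_ord (@ord_ge_power _ _ b)).
apply/eqP/negPn/negP => nz.
have [s As [deg_m eig_m]] := mult_defect_power_support nz.
have s0 : omega_norm lam s != 0.
  apply/eqP/(X_nonres As) => s_nil; move: deg_m lt_m.
  by rewrite s_nil /word_tdeg big_nil add0n mdegD => ->; rewrite ltnn.
(* Of X = L + Y only L contributes, by its eigenvalue. *)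
have stepX a b : (mdeg a + mdeg b = mdeg p + mdeg q)%N ->
    mult_defect (fps_power C a) (vfield X (fps_power C b)) m =
    eigenvalue lam b * mult_defect (fps_power C a) (fps_power C b) m.
  move=> eab; rewrite -fps_scaleE -(linear_morphZ (@mult_defect_linear _)).
  rewrite -linear_part_power; apply/eqP; rewrite -subr_eq0; apply/eqP.
  by rewrite -(step a b eab) (linear_morphB (@mult_defect_linear _)).
have := congr1 (fun f : F => f m)
  (mult_defect_derivation (fps_power C p) (fps_power C q)).
rewrite /= linear_part_coef fps_addE [in RHS]mult_defectC !stepX //; last first.
  exact: addnC.
rewrite (mult_defectC (fps_power C q)) eig_m eigenvalueD => /eqP.
rewrite -mulrDl -subr_eq0 -mulrBl addrK mulf_eq0 (negbTE s0) /=.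
by rewrite (negbTE nz).
Qed.

Lemma Na_op_mul f g : Na_op (f * g) = Na_op f * Na_op g.
Proof.
suff d0 m : mult_defect f g m = 0.
  by apply/eqP; rewrite -subr_eq0; apply/eqP/funext => m; apply: d0.
have on_powers (a h : F) : (forall p, mult_defect a (fps_power C p) m = 0) ->
    mult_defect a h m = 0.
  move=> h0; pose phi h := mult_defect a h m.
  apply: (functional_eq0 (phi := phi) (M := (mdeg m).+1)).
  - by move=> x b b'; rewrite /phi mult_defect_linear.
  - move=> b bm; apply: (mult_defect_ord (@ord_ge0 _ _ _) bm).
    by rewrite add0n ltnW.
  - by move=> p _; apply: h0.
apply: (on_powers) => q; rewrite mult_defectC; apply: (on_powers) => p.
exact: mult_defect_power.
Qed.

(** * Linearization *)

Lemma Na_op_bijective : bijective Na_op.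
Proof.
have [| |inv invK Kinv] := @unipotent_bijective _ _ (fun f => Na_op f - f).
- move=> a f g; rewrite Na_op_linear scalerBr opprD.
  by rewrite addrACA.
- exact: Na_op_sub_id_ord.
exists inv => f; first by rewrite -[RHS]invK addrC subrK.
by rewrite -[RHS]Kinv addrC subrK.
Qed.

(** By multiplicativity Na 1 is neutral for products with elements of the image
of Na, that is, with every series. *)
Lemma Na_op_one : Na_op 1 = 1.
Proof.
have [inv _ Kinv] := Na_op_bijective.
by rewrite -[Na_op 1]mul1r -{1}[1]Kinv -Na_op_mul mulr1 Kinv.
Qed.

End Linearization.

Theorem mainTheorem8 (R : realType) (nu : nat)
    (X : 'I_nu -> fps nu R[i]) (lam : 'I_nu -> R[i])
    (A : set (degree nu)) (D : degree nu -> fps nu R[i] -> fps nu R[i])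
    (X_prepared : prepared_analytic X lam)
    (X_decomposition : homogeneous_decomposition
       (fun f => vfield X f - vfield (linear_part lam) f) A D)
    (X_non_resonant : non_resonant lam A) :
  exists Na : {lrmorphism fps nu R[i] -> fps nu R[i]},
    linearizes X lam Na /\
    operator_sum (words A) (fun s f => Na_coef lam s *: word_op D s f) Na.
Proof.
pose N := Na_op lam A D.
have N_lin : linear N := Na_op_linear X_decomposition.
have N_mul : monoid_morphism N.
  split; first exact: Na_op_one X_decomposition X_non_resonant.
  exact: Na_op_mul X_decomposition X_non_resonant.
pose Na : {lrmorphism fps nu R[i] -> fps nu R[i]} := HB.pack N
  (GRing.isLinear.Build _ _ _ _ N N_lin)
  (GRing.isMonoidMorphism.Build _ _ N N_mul).
exists Na; split.
  have [Nainv NaK NainvK] := Na_op_bijective X_decomposition.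
  exists Nainv; split=> // f /=.
  transitivity (vfield (linear_part lam) (N (Nainv f))).
    exact: congr1 (esym (NainvK f)).
  exact: Na_op_intertwines X_decomposition X_non_resonant (Nainv f).
move=> f m; split=> //.
apply: sub_finite_set (short_words_finite X_decomposition (mdeg m)).
move=> s [As nz]; split=> //; rewrite leqNgt; apply: contra_neqN nz => long_s.
by rewrite fps_scaleE (word_op_long X_decomposition) ?mulr0.
Qed.
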